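(* Working in $\mathsf{ZF}$, the following are equivalent: (1) Every foliated tree is an associative poset. (2) Every tree with finite branches is an associative poset. (3) Every tree of height $3$ is an associative poset. (4) The Axiom of Choice.
   Context: A binary operation $\cdot$ on a poset $(P,\leq)$ is admissible if for all $x,y\in P$: $x\leq y \iff x\cdot y=x$. A right-regular band (RRB) is a set with an associative binary operation satisfying $x\cdot x=x$ and $x\cdot y\cdot x=y\cdot x$. A poset is associative if it admits an admissible RRB operation (i.e. it is the underlying order of some RRB). A tree is a poset $(T,\leq)$ with a top element such that for every $x\in T$ the set $x{\uparrow}=\{y\in T: x\leq y\}$ is linearly ordered. A tree has finite branches if every chain in it is finite; a tree with finite branches has height $n$ if every chain has at most $n$ elements and some chain has exactly $n$ elements. A tree is foliated if for every $x\in T$ there is a minimal element of $T$ below $x$. *)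

(* Defs.v *)
(** A statement "in ZF" is read as a statement about every model of
    first-order ZF.  Every set-theoretic notion below is relativised to such a
    structure: quantifiers range over its elements only, so each predicate is
    the interpretation of a first-order formula in the language of sets.  In
    particular functions, finiteness and choice are those of the model, not
    those of the ambient type theory. *)

Record membership_structure := {
  univ :> Type;
  mem : univ -> univ -> Prop
}.

Arguments mem {_} _ _.
Notation "x ∈ y" := (mem x y) (at level 70, no associativity).

(** ** First-order formulas, with de Bruijn indices *)

Inductive formula : Type :=
| Fmem (i j : nat)
| Feq (i j : nat)
| Fbot
| Fand (p q : formula)
| For (p q : formula)
| Fimp (p q : formula)
| Fall (p : formula)
| Fex (p : formula).

Definition scons {V : Type} (x : V) (e : nat -> V) (n : nat) : V :=
  match n with
  | 0 => x
  | S k => e k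
  end.

Fixpoint sat (V : membership_structure) (e : nat -> V) (p : formula) : Prop :=
  match p with
  | Fmem i j => e i ∈ e j
  | Feq i j => e i = e j
  | Fbot => False
  | Fand p q => sat V e p /\ sat V e q
  | For p q => sat V e p \/ sat V e q
  | Fimp p q => sat V e p -> sat V e q
  | Fall p => forall x : V, sat V (scons x e) p
  | Fex p => exists x : V, sat V (scons x e) p
  end.

(** ** The axioms of ZF *)

Definition subset {V : membership_structure} (x y : V) : Prop :=
  forall z, z ∈ x -> z ∈ y.

Definition is_empty {V : membership_structure} (x : V) : Prop :=
  forall z, ~ z ∈ x.

Definition is_union {V : membership_structure} (u a : V) : Prop :=
  forall z, z ∈ u <-> exists y, y ∈ a /\ z ∈ y.

Definition is_succ {V : membership_structure} (s x : V) : Prop :=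
  forall z, z ∈ s <-> z ∈ x \/ z = x.

Definition is_upair {V : membership_structure} (p x y : V) : Prop :=
  forall z, z ∈ p <-> z = x \/ z = y.

Definition inductive {V : membership_structure} (w : V) : Prop :=
  (exists z, is_empty z /\ z ∈ w) /\
  (forall x, x ∈ w -> exists s, is_succ s x /\ s ∈ w).

(** In the two schemas the environment [e] supplies arbitrary parameters. *)
Record ZF (V : membership_structure) : Prop := {
  ZF_extensionality : forall x y : V, (forall z, z ∈ x <-> z ∈ y) -> x = y;
  ZF_foundation : forall x : V, (exists y, y ∈ x) ->
    exists y, y ∈ x /\ ~ exists z, z ∈ x /\ z ∈ y;
  ZF_pairing : forall x y : V, exists p, is_upair p x y;
  ZF_union : forall a : V, exists u, is_union u a;
  ZF_powerset : forall a : V, exists p, forall z, z ∈ p <-> subset z a;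
  ZF_infinity : exists w : V, inductive w;
  ZF_separation : forall (p : formula) (e : nat -> V) (a : V),
    exists b, forall x, x ∈ b <-> x ∈ a /\ sat V (scons x e) p;
  ZF_replacement : forall (p : formula) (e : nat -> V) (a : V),
    (forall x y y', x ∈ a ->
       sat V (scons x (scons y e)) p -> sat V (scons x (scons y' e)) p ->
       y = y') ->
    exists b, forall y,
      y ∈ b <-> exists x, x ∈ a /\ sat V (scons x (scons y e)) p
}.

(** ** Pairs, relations and functions as sets *)

(** Kuratowski pairs: [p = {{x}, {x, y}}]. *)
Definition is_opair {V : membership_structure} (p x y : V) : Prop :=
  exists a b, is_upair a x x /\ is_upair b x y /\ is_upair p a b.

Definition rel {V : membership_structure} (R x y : V) : Prop :=
  exists p, is_opair p x y /\ p ∈ R.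

Definition is_product {V : membership_structure} (C A B : V) : Prop :=
  forall p, p ∈ C <-> exists x y, x ∈ A /\ y ∈ B /\ is_opair p x y.

Definition is_relation {V : membership_structure} (R A B : V) : Prop :=
  forall p, p ∈ R -> exists x y, x ∈ A /\ y ∈ B /\ is_opair p x y.

Definition is_function {V : membership_structure} (f A B : V) : Prop :=
  is_relation f A B /\ forall x, x ∈ A -> exists! y, rel f x y.

Definition is_injection {V : membership_structure} (f A B : V) : Prop :=
  is_function f A B /\ forall x x' y, rel f x y -> rel f x' y -> x = x'.

Definition is_bijection {V : membership_structure} (f A B : V) : Prop :=
  is_injection f A B /\ forall y, y ∈ B -> exists x, rel f x y.

(** ** Natural numbers (von Neumann) and finiteness *)

Definition natural {V : membership_structure} (n : V) : Prop :=
  forall w, inductive w -> n ∈ w.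

Fixpoint is_numeral {V : membership_structure} (k : nat) (n : V) : Prop :=
  match k with
  | 0 => is_empty n
  | S k => exists m, is_numeral k m /\ is_succ n m
  end.

Definition has_card {V : membership_structure} (A n : V) : Prop :=
  exists f, is_bijection f A n.

Definition has_card_le {V : membership_structure} (A n : V) : Prop :=
  exists f, is_injection f A n.

Definition finite {V : membership_structure} (A : V) : Prop :=
  exists n, natural n /\ has_card A n.

(** ** Posets *)

Definition is_poset {V : membership_structure} (P R : V) : Prop :=
  is_relation R P P /\
  (forall x, x ∈ P -> rel R x x) /\
  (forall x y, x ∈ P -> y ∈ P -> rel R x y -> rel R y x -> x = y) /\
  (forall x y z, x ∈ P -> y ∈ P -> z ∈ P ->
     rel R x y -> rel R y z -> rel R x z).

Definition is_chain {V : membership_structure} (P R C : V) : Prop :=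
  subset C P /\ forall x y, x ∈ C -> y ∈ C -> rel R x y \/ rel R y x.

Definition is_minimal {V : membership_structure} (P R m : V) : Prop :=
  m ∈ P /\ forall y, y ∈ P -> rel R y m -> y = m.

(** ** Right-regular bands and associative posets *)

Definition is_binop {V : membership_structure} (m P : V) : Prop :=
  exists C, is_product C P P /\ is_function m C P.

(** [op m x y z] says that [x · y = z] for the operation [m]. *)
Definition op {V : membership_structure} (m x y z : V) : Prop :=
  exists p, is_opair p x y /\ rel m p z.

Definition is_RRB {V : membership_structure} (P m : V) : Prop :=
  is_binop m P /\
  (forall x y z xy yz a b, x ∈ P -> y ∈ P -> z ∈ P ->
     op m x y xy -> op m xy z a -> op m y z yz -> op m x yz b -> a = b) /\
  (forall x, x ∈ P -> op m x x x) /\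
  (forall x y xy a b, x ∈ P -> y ∈ P ->
     op m x y xy -> op m xy x a -> op m y x b -> a = b).

Definition admissible {V : membership_structure} (P R m : V) : Prop :=
  is_binop m P /\
  forall x y, x ∈ P -> y ∈ P -> (rel R x y <-> op m x y x).

Definition associative_poset {V : membership_structure} (P R : V) : Prop :=
  is_poset P R /\ exists m, is_RRB P m /\ admissible P R m.

(** ** Trees *)

Definition is_tree {V : membership_structure} (T R : V) : Prop :=
  is_poset T R /\
  (exists t, t ∈ T /\ forall x, x ∈ T -> rel R x t) /\
  (forall x y z, x ∈ T -> y ∈ T -> z ∈ T ->
     rel R x y -> rel R x z -> rel R y z \/ rel R z y).

Definition has_finite_branches {V : membership_structure} (T R : V) : Prop :=
  forall C, is_chain T R C -> finite C.

Definition has_height {V : membership_structure} (T R n : V) : Prop :=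
  has_finite_branches T R /\
  (forall C, is_chain T R C -> has_card_le C n) /\
  (exists C, is_chain T R C /\ has_card C n).

Definition foliated {V : membership_structure} (T R : V) : Prop :=
  forall x, x ∈ T -> exists m, is_minimal T R m /\ rel R m x.

(** ** The four statements, relativised to a structure *)

Definition foliated_trees_associative (V : membership_structure) : Prop :=
  forall T R : V, is_tree T R -> foliated T R -> associative_poset T R.

Definition finite_branch_trees_associative (V : membership_structure) : Prop :=
  forall T R : V,
    is_tree T R -> has_finite_branches T R -> associative_poset T R.

Definition height_trees_associative (k : nat) (V : membership_structure) : Prop :=
  forall T R n : V, is_numeral k n ->
    is_tree T R -> has_height T R n -> associative_poset T R.

Definition axiom_of_choice (V : membership_structure) : Prop :=
  forall A : V, (forall x, x ∈ A -> exists y, y ∈ x) ->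
    exists U f, is_union U A /\ is_function f A U /\
      forall x y, x ∈ A -> rel f x y -> y ∈ x.

(* Main.v *)
From Stdlib Require Import Arith Classical ClassicalEpsilon.
Require Import Defs.

(** All three tree statements give choice through one tree.  For a nonempty
    family [A] of nonempty sets, take a top, one vertex for each [a] in [A], and
    below it one leaf for each element of [a].  In a right-regular band on this
    order [x·y <= y]; if [p] is a leaf, then [p·a] cannot be [a], so it is a
    leaf below [a], and [a |-> p·a] is a choice function.

    Conversely, let [W] well-order a foliated tree and let [l y] be the
    [W]-least minimal element below [y].  Then [l y <= z <= y] implies
    [l z = l y], and this coherence makes the following operation associative:
    [x·y] is the smaller of [x] and [y] when they are comparable, and [l y]
    otherwise.  A tree with finite branches is foliated: otherwise, iterating
    "the [W]-least element strictly below" gives a chain without a least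
    element.

    For the well-ordering, let [c] choose a point in each nonempty subset of
    [X], and consider the least family of subsets closed under
    [h(G) = {x in X | for all B in G, x in B and x <> c(B)}].  A double
    induction shows that for two members [A], [B], either [A] lies in
    [B \ {c(B)}], or [B] lies in [A \ {c(A)}], or [A = B]; then [X] is
    well-ordered by the order in which its points are removed. *)

(** * Definable predicates *)

Fixpoint ren (r : nat -> nat) (p : formula) : formula :=
  let up (n : nat) := match n with 0 => 0 | S k => S (r k) end in
  match p with
  | Fmem i j => Fmem (r i) (r j)
  | Feq i j => Feq (r i) (r j)
  | Fbot => Fbot
  | Fand p q => Fand (ren r p) (ren r q)
  | For p q => For (ren r p) (ren r q)
  | Fimp p q => Fimp (ren r p) (ren r q)
  | Fall p => Fall (ren up p)
  | Fex p => Fex (ren up p)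
  end.

Lemma sat_ren (V : membership_structure) (p : formula) :
  forall (r : nat -> nat) (e e' : nat -> V), (forall n, e n = e' (r n)) ->
  (sat V e p <-> sat V e' (ren r p)).
Proof.
  induction p; intros r e e' E; simpl.
  - rewrite (E i), (E j). tauto.
  - rewrite (E i), (E j). tauto.
  - tauto.
  - rewrite (IHp1 r e e' E), (IHp2 r e e' E). tauto.
  - rewrite (IHp1 r e e' E), (IHp2 r e e' E). tauto.
  - rewrite (IHp1 r e e' E), (IHp2 r e e' E). tauto.
  - split; intros H x; specialize (H x); revert H; apply IHp;
      intros [|n]; simpl; auto.
  - split; intros [x H]; exists x; revert H; apply IHp;
      intros [|n]; simpl; auto.
Qed.

Section Definability.
Context {V : membership_structure}.

Notation env := (nat -> V).

Definition value (a : nat + V) (e : env) : V :=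
  match a with inl i => e i | inr c => c end.

Definition is_term (t : env -> V) : Prop :=
  exists a, forall e, t e = value a e.

(* The indices of the formula are routed by [s] to variables or to parameters
   of the structure, so parameters need no fixed place in the environment. *)
Definition definable (P : env -> Prop) : Prop :=
  exists (p : formula) (s : nat -> nat + V),
    forall e, sat V (fun n => value (s n) e) p <-> P e.

Lemma term_var i : is_term (fun e => e i).
Proof. exists (inl i). reflexivity. Qed.

Lemma term_const c : is_term (fun _ => c).
Proof. exists (inr c). reflexivity. Qed.

Lemma def_atomic (t t' : env -> V) : is_term t -> is_term t' ->
  definable (fun e => t e ∈ t' e) /\ definable (fun e => t e = t' e).
Proof.
  intros [a Ha] [b Hb].
  split; [exists (Fmem 0 1) | exists (Feq 0 1)];
    exists (fun n => match n with 0 => a | _ => b end);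
    intros e; rewrite Ha, Hb; simpl; tauto.
Qed.

Lemma def_mem (t t' : env -> V) : is_term t -> is_term t' ->
  definable (fun e => t e ∈ t' e).
Proof. intros; now apply def_atomic. Qed.

Lemma def_eq (t t' : env -> V) : is_term t -> is_term t' ->
  definable (fun e => t e = t' e).
Proof. intros; now apply def_atomic. Qed.

Lemma def_false : definable (fun _ => False).
Proof. exists Fbot, (fun n => inl n). simpl. tauto. Qed.

(** A binary connective needs one routing for both formulas. The indices of the first formula become
    even, those of the second odd, and the common routing branches on parity. *)
Lemma def_common P Q : definable P -> definable Q ->
  exists p q s, forall e,
    (sat V (fun n => value (s n) e) p <-> P e) /\
    (sat V (fun n => value (s n) e) q <-> Q e).
Proof.
  intros (p & s & Hp) (q & s' & Hq).
  exists (ren (fun n => 2 * n) p), (ren (fun n => 2 * n + 1) q).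
  exists (fun n => if Nat.even n then s (Nat.div2 n) else s' (Nat.div2 n)).
  intros e. rewrite <- Hp, <- Hq. split; symmetry; apply sat_ren; intros n.
  - rewrite Nat.even_even, Nat.div2_double. reflexivity.
  - rewrite Nat.even_odd, Nat.add_1_r, Nat.div2_succ_double. reflexivity.
Qed.

Lemma def_and P Q : definable P -> definable Q ->
  definable (fun e => P e /\ Q e).
Proof.
  intros HP HQ. destruct (def_common P Q HP HQ) as (p & q & s & H).
  exists (Fand p q), s. intros e. destruct (H e). simpl. tauto.
Qed.

Lemma def_or P Q : definable P -> definable Q ->
  definable (fun e => P e \/ Q e).
Proof.
  intros HP HQ. destruct (def_common P Q HP HQ) as (p & q & s & H).
  exists (For p q), s. intros e. destruct (H e). simpl. tauto.
Qed.

Lemma def_imp P Q : definable P -> definable Q ->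
  definable (fun e => P e -> Q e).
Proof.
  intros HP HQ. destruct (def_common P Q HP HQ) as (p & q & s & H).
  exists (Fimp p q), s. intros e. destruct (H e). simpl. tauto.
Qed.

Lemma def_not P : definable P -> definable (fun e => ~ P e).
Proof. intros HP. exact (def_imp _ _ HP def_false). Qed.

Lemma def_iff P Q : definable P -> definable Q ->
  definable (fun e => P e <-> Q e).
Proof. intros HP HQ. apply def_and; now apply def_imp. Qed.

Lemma def_bind (P : env -> V -> Prop) :
  definable (fun e => P (fun n => e (S n)) (e 0)) ->
  exists p s, forall e x,
    sat V (scons x (fun n => value (s n) e)) p <-> P e x.
Proof.
  intros (p & s & H).
  exists (ren (fun n => match s n with inl 0 => 0 | _ => S n end) p).
  (* The value at [inl 0] is a dummy that is never read: those indices have just been renamed to the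
     bound variable [0]. *)
  exists (fun n => match s n with inl (S i) => inl i | inl 0 => inl 0
                                | inr c => inr c end).
  intros e x. rewrite <- (H (scons x e)). symmetry. apply sat_ren.
  intros n. destruct (s n) as [[|i]|c] eqn:E; simpl; try rewrite E; reflexivity.
Qed.

Lemma def_all (P : env -> V -> Prop) :
  definable (fun e => P (fun n => e (S n)) (e 0)) ->
  definable (fun e => forall x, P e x).
Proof.
  intros H. destruct (def_bind P H) as (p & s & Hp).
  exists (Fall p), s. intros e. simpl.
  split; intros K x; apply Hp; apply K.
Qed.

Lemma def_ex (P : env -> V -> Prop) :
  definable (fun e => P (fun n => e (S n)) (e 0)) ->
  definable (fun e => exists x, P e x).
Proof.
  intros H. destruct (def_bind P H) as (p & s & Hp).
  exists (Fex p), s. intros e. simpl.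
  split; intros [x K]; exists x; apply Hp; apply K.
Qed.

Lemma def_subst (P : env -> Prop) (a : nat -> nat + V) :
  definable P -> definable (fun e => P (fun n => value (a n) e)).
Proof.
  intros (p & s & H).
  exists p, (fun n => match s n with inl i => a i | inr c => inr c end).
  intros e. rewrite <- (H (fun n => value (a n) e)).
  rewrite (sat_ren V p (fun n => n) _ (fun n => value (s n) (fun n => value (a n) e))).
  - symmetry. apply sat_ren. reflexivity.
  - intros n. destruct (s n); reflexivity.
Qed.

(** Together with its versions for two and three arguments, this lets [definability] apply a
    hypothesis about an abstract predicate at arbitrary terms. *)
Lemma def_app1 (P : V -> Prop) (t : env -> V) :
  definable (fun e => P (e 0)) -> is_term t -> definable (fun e => P (t e)).
Proof.
  intros HP [a Ha].
  destruct (def_subst _ (fun _ => a) HP) as (p & s & H).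
  exists p, s. intros e. rewrite H, Ha. reflexivity.
Qed.

Lemma def_app2 (P : V -> V -> Prop) (t t' : env -> V) :
  definable (fun e => P (e 0) (e 1)) -> is_term t -> is_term t' ->
  definable (fun e => P (t e) (t' e)).
Proof.
  intros HP [a Ha] [b Hb].
  destruct (def_subst _ (fun n => match n with 0 => a | _ => b end) HP)
    as (p & s & H).
  exists p, s. intros e. rewrite H, Ha, Hb. reflexivity.
Qed.

Lemma def_app3 (P : V -> V -> V -> Prop) (t t' t'' : env -> V) :
  definable (fun e => P (e 0) (e 1) (e 2)) ->
  is_term t -> is_term t' -> is_term t'' ->
  definable (fun e => P (t e) (t' e) (t'' e)).
Proof.
  intros HP [a Ha] [b Hb] [c Hc].
  destruct (def_subst _
    (fun n => match n with 0 => a | 1 => b | _ => c end) HP) as (p & s & H).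
  exists p, s. intros e. rewrite H, Ha, Hb, Hc. reflexivity.
Qed.

End Definability.

(** Once the listed notions are unfolded to membership and equality, definability follows the syntax
    of the predicate. *)
Ltac definability :=
  cbv beta delta [is_minimal is_chain finite natural inductive has_card
    has_card_le is_bijection is_injection is_function is_relation unique op rel
    is_opair is_upair is_succ is_union is_empty subset];
  solve [ repeat (cbv beta; first
    [ assumption
    | apply term_var | apply term_const
    | apply def_mem | apply def_eq | apply def_false
    | apply def_and | apply def_or | apply def_iff | apply def_not
    | apply def_all | apply def_ex | apply def_imp
    | (eapply def_app1; [eassumption |])
    | (eapply def_app2; [eassumption | |])
    | (eapply def_app3; [eassumption | | |]) ]) ].

(** * Sets, relations and functions *)

Section SetTheory.
Context {V : membership_structure} (hZF : ZF V).

Lemma ext (x y : V) : (forall z, z ∈ x <-> z ∈ y) -> x = y.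
Proof. apply (ZF_extensionality V hZF). Qed.

Lemma separation (P : V -> Prop) (a : V) : definable (fun e => P (e 0)) ->
  exists b, forall x, x ∈ b <-> x ∈ a /\ P x.
Proof.
  intros D.
  destruct (def_bind (fun _ x => P x) D) as (p & s & H).
  destruct (ZF_separation V hZF p (fun n => value (s n) (fun _ => a)) a)
    as [b Hb].
  exists b. intros x. rewrite Hb, H. tauto.
Qed.

Lemma empty_ex : exists z : V, is_empty z.
Proof.
  destruct (ZF_infinity V hZF) as (w & (z & Hz & _) & _). now exists z.
Qed.

Lemma upair_ex (x y : V) : exists p, is_upair p x y.
Proof. apply (ZF_pairing V hZF). Qed.

Lemma union2_ex (a b : V) : exists u, forall z, z ∈ u <-> z ∈ a \/ z ∈ b.
Proof.
  destruct (upair_ex a b) as [p Hp].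
  destruct (ZF_union V hZF p) as [u Hu].
  exists u. intros z. rewrite (Hu z). split.
  - intros (y & Hy & Hz). apply Hp in Hy. destruct Hy; subst; auto.
  - intros [H|H]; [exists a | exists b]; rewrite (Hp _); auto.
Qed.

Lemma adjoin_ex (a x : V) : exists b, forall z, z ∈ b <-> z ∈ a \/ z = x.
Proof.
  destruct (upair_ex x x) as [p Hp].
  destruct (union2_ex a p) as [u Hu].
  exists u. intros z. rewrite Hu, (Hp z). tauto.
Qed.

(** Foundation applied to the singleton of [x]. *)
Lemma mem_irrefl (x : V) : ~ x ∈ x.
Proof.
  intros H. destruct (upair_ex x x) as [p Hp].
  destruct (ZF_foundation V hZF p) as (y & Hy & N).
  - exists x. apply Hp. auto.
  - apply Hp in Hy. assert (y = x) by tauto; subst y.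
    apply N. exists x. split; auto. apply Hp; auto.
Qed.

Lemma opair_ex (x y : V) : exists p, is_opair p x y.
Proof.
  destruct (upair_ex x x) as [a Ha], (upair_ex x y) as [b Hb].
  destruct (upair_ex a b) as [p Hp]. now exists p, a, b.
Qed.

Lemma opair_mem (p x y : V) : is_opair p x y ->
  forall u, u ∈ p <-> is_upair u x x \/ is_upair u x y.
Proof.
  intros (a & b & Ha & Hb & Hp) u. rewrite (Hp u). split.
  - intros [->| ->]; auto.
  - intros [H|H]; [left|right]; apply ext; intros z; rewrite (H z);
      [rewrite (Ha z) | rewrite (Hb z)]; tauto.
Qed.

Lemma opair_fun (p q x y : V) : is_opair p x y -> is_opair q x y -> p = q.
Proof.
  intros Hp Hq. apply ext. intros u.
  rewrite (opair_mem p x y Hp), (opair_mem q x y Hq). tauto.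
Qed.

Lemma opair_nonempty (p x y : V) : is_opair p x y -> ~ is_empty p.
Proof.
  intros Hp N. destruct (upair_ex x x) as [a Ha]. apply (N a).
  apply (opair_mem p x y Hp). auto.
Qed.

Lemma opair_inj (p x y x' y' : V) :
  is_opair p x y -> is_opair p x' y' -> x = x' /\ y = y'.
Proof.
  intros H H'.
  destruct (upair_ex x x) as [a Ha], (upair_ex x y) as [b Hb].
  assert (A : a ∈ p) by (apply (opair_mem p x y H); auto).
  assert (B : b ∈ p) by (apply (opair_mem p x y H); auto).
  assert (E : x = x').
  { apply (opair_mem p x' y' H') in A.
    assert (X : x' ∈ a) by (destruct A as [A|A]; apply A; auto).
    apply Ha in X. destruct X; auto. }
  subst x'. split; auto.
  assert (Y : y ∈ b) by (apply Hb; auto).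
  destruct (upair_ex x y') as [b' Hb'].
  assert (B' : b' ∈ p) by (apply (opair_mem p x y' H'); auto).
  assert (Y' : y' ∈ b') by (apply Hb'; auto).
  apply (opair_mem p x y' H') in B. apply (opair_mem p x y H) in B'.
  assert (C : y = x \/ y = y') by (destruct B as [B|B]; apply B in Y; tauto).
  assert (C' : y' = x \/ y' = y) by (destruct B' as [B'|B']; apply B' in Y'; tauto).
  destruct C; subst; auto. destruct C'; auto.
Qed.

(** A Kuratowski pair over [A] and [B] is a set of subsets of their union, so the product is
    separated from the double power set of that union. *)
Lemma product_ex (A B : V) : exists C, is_product C A B.
Proof.
  destruct (union2_ex A B) as [U HU].
  destruct (ZF_powerset V hZF U) as [P HP].
  destruct (ZF_powerset V hZF P) as [Q HQ].
  destruct (separation (fun p => exists x y, x ∈ A /\ y ∈ B /\ is_opair p x y) Q)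
    as [C HC]; [definability|].
  exists C. intros p. rewrite HC. split; [tauto|].
  intros H; split; auto. destruct H as (x & y & Hx & Hy & H).
  apply HQ. intros u Hu. apply HP. intros z Hz. apply HU.
  apply (opair_mem p x y H) in Hu.
  destruct Hu as [Hu|Hu]; apply Hu in Hz; destruct Hz; subst; auto.
Qed.

Lemma relation_ex (A B : V) (G : V -> V -> Prop) :
  definable (fun e => G (e 0) (e 1)) ->
  exists R, is_relation R A B /\
    forall x y, rel R x y <-> x ∈ A /\ y ∈ B /\ G x y.
Proof.
  intros D. destruct (product_ex A B) as [C HC].
  destruct (separation (fun p => exists x y, is_opair p x y /\ G x y) C)
    as [R HR]; [definability|].
  exists R. split.
  - intros p Hp. apply HR in Hp. apply HC, Hp.
  - intros x y. split.
    + intros (p & Hp & M). apply HR in M. destruct M as (M & x' & y' & Hp' & K).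
      apply HC in M. destruct M as (x'' & y'' & Hx & Hy & Hp'').
      destruct (opair_inj _ _ _ _ _ Hp Hp'), (opair_inj _ _ _ _ _ Hp Hp'').
      subst; auto.
    + intros (Hx & Hy & K). destruct (opair_ex x y) as [p Hp].
      exists p. split; auto. apply HR. split.
      * apply HC. exists x, y; auto.
      * exists x, y; auto.
Qed.

Lemma relation_dom (R A B x y : V) : is_relation R A B -> rel R x y ->
  x ∈ A /\ y ∈ B.
Proof.
  intros H (p & Hp & M). destruct (H p M) as (x' & y' & Hx & Hy & Hp').
  destruct (opair_inj _ _ _ _ _ Hp Hp'). subst; auto.
Qed.

Lemma function_ex (A B : V) (G : V -> V -> Prop) :
  definable (fun e => G (e 0) (e 1)) ->
  (forall x, x ∈ A -> exists y, y ∈ B /\ G x y) ->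
  (forall x y y', x ∈ A -> G x y -> G x y' -> y = y') ->
  exists f, is_function f A B /\
    forall x y, rel f x y <-> x ∈ A /\ y ∈ B /\ G x y.
Proof.
  intros D T F. destruct (relation_ex A B G D) as (f & Hf & HR).
  exists f. split; auto. split; auto.
  intros x Hx. destruct (T x Hx) as (y & Hy & K). exists y. split.
  - apply HR; auto.
  - intros y' H. apply HR in H. apply (F x); tauto.
Qed.

(** [F] belongs to the ambient logic and may be defined by cases there; it is the definable graph
    [G] that makes the operation a set of the structure. *)
Lemma binop_ex (P : V) (G : V -> V -> V -> Prop) (F : V -> V -> V) :
  definable (fun e => G (e 0) (e 1) (e 2)) ->
  (forall x y z, x ∈ P -> y ∈ P -> G x y z <-> z = F x y) ->
  (forall x y, x ∈ P -> y ∈ P -> F x y ∈ P) ->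
  exists m, is_binop m P /\
    forall x y z, op m x y z <-> x ∈ P /\ y ∈ P /\ z = F x y.
Proof.
  intros D HG HF. destruct (product_ex P P) as [C HC].
  destruct (function_ex C P
    (fun p z => exists x y, is_opair p x y /\ G x y z)) as (m & Hm & HR).
  - definability.
  - intros p Hp. apply HC in Hp. destruct Hp as (x & y & Hx & Hy & Hp).
    exists (F x y). split; auto. exists x, y. rewrite HG; auto.
  - intros p z z' Hp (x & y & K & H) (x' & y' & K' & H').
    apply HC in Hp. destruct Hp as (x0 & y0 & Hx & Hy & Hp).
    destruct (opair_inj _ _ _ _ _ K Hp), (opair_inj _ _ _ _ _ K' Hp). subst.
    apply HG in H; auto. apply HG in H'; auto. congruence.
  - exists m. split; [now exists C|]. intros x y z. unfold op. split.
    + intros (p & Hp & H). apply HR in H.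
      destruct H as (HpC & Hz & x' & y' & Hp' & H).
      destruct (opair_inj _ _ _ _ _ Hp Hp'). subst x' y'.
      apply HC in HpC. destruct HpC as (x' & y' & Hx & Hy & Hp'').
      destruct (opair_inj _ _ _ _ _ Hp Hp''). subst x' y'.
      rewrite <- HG; auto.
    + intros (Hx & Hy & ->). destruct (opair_ex x y) as [p Hp].
      exists p. split; auto. apply HR. repeat split; auto.
      * apply HC. exists x, y; auto.
      * exists x, y. rewrite HG; auto.
Qed.

(** Description in the ambient logic turns the set [m] into a function, so that the band laws become
    equations to rewrite with. *)
Lemma binop_fun (m P : V) : is_binop m P -> exists F : V -> V -> V,
  forall x y, x ∈ P -> y ∈ P ->
    F x y ∈ P /\ forall z, op m x y z <-> z = F x y.
Proof.
  intros (C & HC & Hm & Hf).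
  assert (K : forall x y, exists w, x ∈ P -> y ∈ P ->
    w ∈ P /\ forall z, op m x y z <-> z = w).
  (* Outside [P] the value is an arbitrary default. *)
  { intros x y. destruct (classic (x ∈ P /\ y ∈ P)) as [[Hx Hy]|N];
      [|exists x; tauto].
    destruct (opair_ex x y) as [p Hp].
    destruct (Hf p) as (w & Hw & U); [apply HC; exists x, y; auto|].
    exists w. intros _ _. split; [now apply (relation_dom m C P p)|].
    intros z. split.
    - intros (q & Hq & H). rewrite (opair_fun q p x y Hq Hp) in H.
      symmetry; auto.
    - intros ->. exists p; auto. }
  exists (fun x y => proj1_sig (constructive_indefinite_description _ (K x y))).
  intros x y. destruct (constructive_indefinite_description _ (K x y)). auto.
Qed.

End SetTheory.

(** * Finite sets *)

Section Finiteness.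
Context {V : membership_structure} (hZF : ZF V).

(** The elements satisfying [P] of any inductive set again form an inductive set, which therefore
    contains every natural number. *)
Lemma natural_ind (P : V -> Prop) : definable (fun e => P (e 0)) ->
  (forall n, is_empty n -> P n) ->
  (forall n s, P n -> is_succ s n -> P s) ->
  forall n, natural n -> P n.
Proof.
  intros D H0 HS n Hn.
  destruct (ZF_infinity V hZF) as [w [(z & Hz & Hzw) Hw]].
  destruct (separation hZF P w D) as [w' Hw'].
  apply (Hw' n). apply Hn. split.
  - exists z. split; auto. apply Hw'. auto.
  - intros x Hx. apply Hw' in Hx. destruct Hx as [Hx Px].
    destruct (Hw x Hx) as (s & Hs & Hsw). exists s. split; auto.
    apply Hw'. eauto.
Qed.

Lemma natural_empty (n : V) : is_empty n -> natural n.
Proof.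
  intros H w [(z & Hz & Hzw) _]. replace n with z; auto.
  apply (ext hZF). intros u. specialize (H u). specialize (Hz u). tauto.
Qed.

Lemma natural_succ (n s : V) : natural n -> is_succ s n -> natural s.
Proof.
  intros Hn Hs w Hw. destruct (proj2 Hw n (Hn w Hw)) as (s' & Hs' & H).
  replace s with s'; auto.
  apply (ext hZF). intros u. rewrite (Hs u), (Hs' u). tauto.
Qed.

Lemma natural_numeral k : forall n : V, is_numeral k n -> natural n.
Proof.
  induction k; simpl; intros n H.
  - now apply natural_empty.
  - destruct H as (m & Hm & H). apply (natural_succ m); auto.
Qed.

Lemma numeral_ex k : exists n : V, is_numeral k n.
Proof.
  induction k as [|k [m Hm]].
  - apply (empty_ex hZF).
  - destruct (adjoin_ex hZF m m) as [s Hs]. exists s, m. auto.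
Qed.

Lemma injection_ex (A B : V) (G : V -> V -> Prop) :
  definable (fun e => G (e 0) (e 1)) ->
  (forall x, x ∈ A -> exists y, y ∈ B /\ G x y) ->
  (forall x y y', x ∈ A -> G x y -> G x y' -> y = y') ->
  (forall x x' y, x ∈ A -> x' ∈ A -> G x y -> G x' y -> x = x') ->
  exists f, is_injection f A B /\
    forall x y, rel f x y <-> x ∈ A /\ y ∈ B /\ G x y.
Proof.
  intros D T F I. destruct (function_ex hZF A B G D T F) as (f & Hf & HR).
  exists f. split; auto. split; auto.
  intros x x' y H H'. apply HR in H. apply HR in H'. apply (I x x' y); tauto.
Qed.

(** At most one point is sent to [n], the last element of [s]; without it the injection lands in
    [n]. *)
Lemma card_le_succ (n s C : V) : is_succ s n -> has_card_le C s ->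
  exists C', has_card_le C' n /\
    (C' = C \/ exists x, ~ x ∈ C' /\ forall z, z ∈ C <-> z ∈ C' \/ z = x).
Proof.
  intros Hs (f & [Hr Hf] & Hi).
  destruct (separation hZF (fun x => ~ rel f x n) C) as [C' HC'];
    [definability|].
  exists C'. split.
  - destruct (injection_ex C' n (rel f)) as (g & Hg & _);
      [definability | | | | now exists g].
    + intros x Hx. apply HC' in Hx. destruct Hx as [Hx N].
      destruct (Hf x Hx) as (y & Hy & _). exists y. split; auto.
      destruct (relation_dom hZF f C s x y Hr Hy) as [_ M].
      apply Hs in M. destruct M; subst; tauto.
    + intros x y y' Hx H H'. apply HC' in Hx.
      destruct (Hf x) as (w & _ & U); [tauto|].
      rewrite <- (U y H). auto.
    + intros x x' y _ _. apply Hi.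
  - destruct (classic (exists x, rel f x n)) as [[x Hx]|N].
    + right. exists x. rewrite HC'. split; [tauto|].
      intros z. rewrite HC'. split.
      * intros Hz. destruct (classic (rel f z n)) as [K|K]; auto.
        right. eapply Hi; eauto.
      * intros [H| ->]; [tauto|]. now apply (relation_dom hZF f C s x n).
    + left. apply (ext hZF). intros z. rewrite HC'.
      split; [tauto|]. intros Hz; split; auto. eauto.
Qed.

(** Induction on the bound rather than on the cardinality: when the last element is not attained,
    the set stays the same and only the bound drops. *)
Lemma card_le_ind (Q : V -> Prop) : definable (fun e => Q (e 0)) ->
  (forall C, is_empty C -> Q C) ->
  (forall C x C', Q C -> ~ x ∈ C ->
     (forall z, z ∈ C' <-> z ∈ C \/ z = x) -> Q C') ->
  forall n C, natural n -> has_card_le C n -> Q C.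
Proof.
  intros D H0 HS n C Hn. revert C.
  apply (natural_ind (fun n => forall C, has_card_le C n -> Q C));
    auto.
  - definability.
  - intros m Hm C (f & [Hr Hf] & _). apply H0. intros x Hx.
    destruct (Hf x Hx) as (y & Hy & _).
    apply (Hm y). now apply (relation_dom hZF f C m x y).
  - intros m s IH Hs C HC.
    destruct (card_le_succ m s C Hs HC) as (C' & HC' & [<-|(x & Hx & K)]); auto.
    apply (HS C' x); auto.
Qed.

Lemma finite_empty (C : V) : is_empty C -> finite C.
Proof.
  intros HC. exists C. split; [now apply natural_empty|].
  destruct (injection_ex C C (fun x y => x = y)) as (f & Hf & _);
    [definability | | | |].
  - intros x Hx. now destruct (HC x).
  - congruence.
  - congruence.
  - exists f. split; auto. intros y Hy. now destruct (HC y).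
Qed.

(** The bijection is extended by sending [x] to [n], which is a new value because no set is a member
    of itself. *)
Lemma finite_adjoin (C x C' : V) : finite C -> ~ x ∈ C ->
  (forall z, z ∈ C' <-> z ∈ C \/ z = x) -> finite C'.
Proof.
  intros (n & Hn & f & [[Hr Hf] Hi] & Hs) N HC'.
  destruct (adjoin_ex hZF n n) as [s Es].
  exists s. split; [now apply (natural_succ n)|].
  assert (Dom : forall u v, rel f u v -> u ∈ C /\ v ∈ n)
    by (intros; now apply (relation_dom hZF f C n)).
  destruct (injection_ex C' s (fun u v => rel f u v \/ u = x /\ v = n))
    as (g & Hg & HR); [definability | | | |].
  - intros u Hu. apply HC' in Hu. destruct Hu as [Hu| ->].
    + destruct (Hf u Hu) as (v & Hv & _). exists v. split; auto.
      apply Es. left. now apply (Dom u).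
    + exists n. split; auto. apply Es; auto.
  - intros u v v' Hu [H|[-> ->]] [H'|[E E']]; subst.
    + destruct (Hf u) as (w & _ & U); [now apply (Dom u v)|].
      rewrite <- (U v H). auto.
    + destruct (Dom x v H); tauto.
    + destruct (Dom x v' H'); tauto.
    + reflexivity.
  - intros u u' v Hu Hu' [H|[-> ->]] [H'|[E E']]; subst.
    + eapply Hi; eauto.
    + apply Dom in H. destruct H as [_ H]. now apply (mem_irrefl hZF) in H.
    + apply Dom in H'. destruct H' as [_ H']. now apply (mem_irrefl hZF) in H'.
    + reflexivity.
  - exists g. split; auto. intros y Hy. pose proof Hy as Hy'.
    apply Es in Hy. destruct Hy as [Hy| ->].
    + destruct (Hs y Hy) as [u Hu]. exists u. apply HR.
      repeat split; auto. apply HC'. left. now apply (Dom u y).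
    + exists x. apply HR. repeat split; auto. apply HC'; auto.
Qed.

Lemma finite_card_le (n C : V) : natural n -> has_card_le C n -> finite C.
Proof.
  apply card_le_ind; [definability | exact finite_empty | exact finite_adjoin].
Qed.

Lemma finite_chain_min (P R C : V) : is_poset P R -> is_chain P R C ->
  finite C -> (exists x, x ∈ C) ->
  exists m, m ∈ C /\ forall y, y ∈ C -> rel R m y.
Proof.
  intros (_ & Refl & _ & Trans) HC (n & Hn & f & Hf & _).
  revert HC. refine (card_le_ind
    (fun C => is_chain P R C -> (exists x, x ∈ C) ->
      exists m, m ∈ C /\ forall y, y ∈ C -> rel R m y)
    _ _ _ n C Hn (ex_intro _ f Hf)).
  - definability.
  - intros D HD _ [x Hx]. now destruct (HD x).
  - intros D x D' IH Hx HD' [Sub Lin] _.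
    assert (XD' : x ∈ D') by (apply HD'; auto).
    assert (DD' : forall z, z ∈ D -> z ∈ D') by (intros; apply HD'; auto).
    destruct (classic (exists y, y ∈ D)) as [NE|E].
    + destruct IH as (m & Hm & Min); auto.
      { split; [intros z Hz; auto | intros; auto]. }
      (* The smaller of the new point and the old least element is least. *)
      destruct (Lin x m) as [L|L]; auto.
      * exists x. split; auto. intros y Hy. apply HD' in Hy.
        destruct Hy as [Hy| ->]; auto. apply (Trans x m y); auto.
      * exists m. split; auto. intros y Hy. apply HD' in Hy.
        destruct Hy as [Hy| ->]; auto.
    + exists x. split; auto. intros y Hy. apply HD' in Hy.
      destruct Hy as [Hy| ->]; auto. exfalso; eauto.
Qed.

End Finiteness.

(** * The well-ordering theorem *)

Section WellOrdering.
Context {V : membership_structure} (hZF : ZF V).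

(* [A] is the set h(G) of the header. *)
Definition trim (c X G A : V) : Prop :=
  forall x, x ∈ A <-> x ∈ X /\ forall B, B ∈ G -> x ∈ B /\ ~ rel c B x.

(** Membership in every closed set [F] expresses membership in the least closed family. For empty
    [G] the trim is [X] itself, the first stage of the removal. *)
Definition tower (c X A : V) : Prop :=
  forall F, (forall G B, subset G F -> trim c X G B -> B ∈ F) -> A ∈ F.

Lemma tower_closed (c X G A : V) :
  (forall B, B ∈ G -> tower c X B) -> trim c X G A -> tower c X A.
Proof.
  intros HG HA F HF. apply (HF G); auto. intros B HB. apply HG; auto.
Qed.

(** Every trim is a subset of [X], so the tower members satisfying [P] can be separated from the
    power set of [X]; they form a closed set. *)
Lemma tower_ind (c X : V) (P : V -> Prop) : definable (fun e => P (e 0)) ->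
  (forall G A, (forall B, B ∈ G -> tower c X B /\ P B) -> trim c X G A ->
    P A) ->
  forall A, tower c X A -> P A.
Proof.
  intros D H A HA. destruct (ZF_powerset V hZF X) as [Q HQ].
  destruct (separation hZF (fun A => tower c X A /\ P A) Q) as [F HF].
  { unfold tower, trim. definability. }
  apply (HF A). apply HA. intros G B HG HB. apply HF. repeat split.
  - apply HQ. intros x Hx. now apply HB in Hx.
  - apply (tower_closed c X G); auto. intros E HE. now apply HF, HG.
  - apply (H G); auto. intros E HE. now apply HF, HG.
Qed.

Definition below (c A B : V) : Prop :=
  forall x, x ∈ A -> x ∈ B /\ ~ rel c B x.

Lemma tower_trichotomy (c X A B : V) : tower c X A -> tower c X B ->
  below c A B \/ below c B A \/ A = B.
Proof.
  intros HA HB. revert A HA B HB.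
  refine (tower_ind c X (fun A => forall B, tower c X B ->
    below c A B \/ below c B A \/ A = B) _ _).
  { unfold tower, trim, below. definability. }
  intros G A HG HA.
  refine (tower_ind c X (fun B =>
    below c A B \/ below c B A \/ A = B) _ _).
  { unfold below. definability. }
  intros H B HH HB.
  assert (TB : tower c X B)
    by (apply (tower_closed c X H); auto; intros; now apply HH).
  assert (AD : forall D, D ∈ G -> below c A D)
    by (intros D HD x Hx; apply HA in Hx; now apply Hx).
  assert (BE : forall E, E ∈ H -> below c B E)
    by (intros E HE x Hx; apply HB in Hx; now apply Hx).
  (* By the outer induction hypothesis such a [D] equals [B] or is below it, and [A] is contained in
     [D]. *)
  destruct (classic (exists D, D ∈ G /\ ~ below c B D)) as [(D & HD & N)|HG'].
  { left. destruct (HG D HD) as [_ T].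
    destruct (T B TB) as [K|[K| <-]]; [|tauto|auto].
    intros x Hx. apply K. now apply (AD D HD). }
  (* The symmetric case, by the inner induction hypothesis. *)
  destruct (classic (exists E, E ∈ H /\ ~ below c A E)) as [(E & HE & N)|HH'].
  { right; left. destruct (HH E HE) as [_ K].
    destruct K as [K|[K| ->]]; [tauto| |auto].
    intros x Hx. apply K. now apply (BE E HE). }
  (* Now [A] is below every member of [H] and [B] below every member of [G], so each satisfies the
     condition defining the other. *)
  right; right. apply (ext hZF). intros x. split; intros Hx.
  - apply HB. split; [now apply HA in Hx|]. intros E HE.
    apply NNPP. intros N. apply HH'. exists E. split; auto.
  - apply HA. split; [now apply HB in Hx|]. intros D HD.
    apply NNPP. intros N. apply HG'. exists D. split; auto.
Qed.

(** Reflexivity, totality and transitivity on [X] follow by taking for [Y] sets of one, two and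
    three points. *)
Definition well_orders (W X : V) : Prop :=
  (forall x y, rel W x y -> rel W y x -> x = y) /\
  forall Y, subset Y X -> (exists y, y ∈ Y) ->
    exists z, z ∈ Y /\ forall w, w ∈ Y -> rel W z w.

Lemma choice_on_subsets (X : V) : axiom_of_choice V -> exists c : V,
  (forall Y y y', rel c Y y -> rel c Y y' -> y = y') /\
  forall Y, subset Y X -> (exists y, y ∈ Y) -> exists y, y ∈ Y /\ rel c Y y.
Proof.
  intros AC. destruct (ZF_powerset V hZF X) as [Q HQ].
  destruct (separation hZF (fun Y => exists y, y ∈ Y) Q) as [A HA];
    [definability|].
  destruct (AC A) as (U & c & _ & [Hr Hf] & Hc).
  { intros Y HY. now apply HA. }
  exists c. split.
  - intros Y y y' H H'. destruct (Hf Y) as (w & _ & Uq).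
    + now apply (relation_dom hZF c A U Y y).
    + rewrite <- (Uq y H). auto.
  - intros Y HY NE. assert (M : Y ∈ A) by (apply HA; split; auto; now apply HQ).
    destruct (Hf Y M) as (y & Hy & _). exists y.
    split; [now apply (Hc Y) | exact Hy].
Qed.

Lemma well_ordering (X : V) : axiom_of_choice V -> exists W, well_orders W X.
Proof.
  intros AC. destruct (choice_on_subsets X AC) as (c & Fun & Tot).
  destruct (ZF_powerset V hZF X) as [Q HQ].
  assert (TX : forall A, tower c X A -> subset A X).
  { refine (tower_ind c X (fun A => subset A X) _ _); [definability|].
    intros G A _ HA x Hx. apply HA in Hx. exact (proj1 Hx). }
  (* [z] precedes [w] when [z] is the point removed from a stage that still contains [w]. *)
  destruct (relation_ex hZF X X (fun z w =>
    exists A, tower c X A /\ z ∈ A /\ rel c A z /\ w ∈ A)) as (W & _ & HW).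
  { unfold tower, trim. definability. }
  exists W. split.
  - intros x y H H'. apply HW in H. apply HW in H'.
    destruct H as (_ & _ & A & HA & Hx & Hc & Hy).
    destruct H' as (_ & _ & A' & HA' & Hy' & Hc' & Hx').
    (* If one stage were below the other, it would lack the point chosen in the larger one, yet it
       contains that point. So the stages agree, and so do their chosen points. *)
    destruct (tower_trichotomy c X A A' HA HA') as [K|[K| ->]].
    + now destruct (K y Hy).
    + now destruct (K x Hx').
    + eapply Fun; eauto.
  - intros Y HY NE.
    (* [G] collects the stages whose chosen point can be removed without losing any of [Y]. Its trim
       [A] is the last stage containing [Y], and the point chosen in [A] will be the least element
       of [Y]. *)
    destruct (separation hZF (fun B => tower c X B /\ below c Y B) Q)
      as [G HG]; [unfold tower, trim, below; definability|].
    destruct (separation hZF (fun x => forall B, B ∈ G ->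
      x ∈ B /\ ~ rel c B x) X) as [A HA]; [definability|].
    assert (TA : tower c X A).
    { apply (tower_closed c X G); [|exact HA]. intros B HB. now apply HG. }
    assert (YA : subset Y A).
    { intros y Hy. apply HA. split; auto. intros B HB.
      apply HG in HB. now apply HB. }
    destruct (Tot A) as (z & Hz & Hc); [now apply TX| |].
    { destruct NE as [y Hy]. exists y. auto. }
    exists z. assert (M : z ∈ Y).
    { (* otherwise [Y] lies in [A] minus its chosen point, which forces [A] into [G] *)
      apply NNPP. intros N. assert (HAG : A ∈ G).
      { apply HG. split; [now apply HQ, TX|]. split; [exact TA|].
        intros x Hx. split; [now apply YA|]. intros K.
        apply N. now rewrite (Fun A z x). }
      pose proof Hz as Hz'. apply HA in Hz'. now apply (proj2 Hz' A). }
    split; auto. intros w Hw. apply HW. repeat split; auto.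
    exists A. auto.
Qed.

End WellOrdering.

(** * Trees under choice *)

Section Trees.
Context {V : membership_structure} (hZF : ZF V).

Lemma choice_foliated_associative (T R : V) : axiom_of_choice V ->
  is_tree T R -> foliated T R -> associative_poset T R.
Proof.
  intros AC [HP [_ HT]] HF. split; auto.
  pose proof HP as (Rel & Refl & Anti & Trans).
  destruct (well_ordering hZF T AC) as (W & WA & WO).
  (* This is the definable graph of the function [l] below, needed to obtain the operation as a
     set. *)
  set (leaf y z := is_minimal T R z /\ rel R z y /\
    forall w, is_minimal T R w -> rel R w y -> rel W z w).
  assert (leaf_ex : forall y, exists z, y ∈ T -> leaf y z).
  { intros y. destruct (classic (y ∈ T)) as [Hy|N]; [|exists y; tauto].
    destruct (separation hZF (fun z => is_minimal T R z /\ rel R z y) T)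
      as [M HM]; [definability|].
    destruct (WO M) as (z & Hz & Min).
    - intros z Hz. now apply HM.
    - destruct (HF y Hy) as (m & Hm & Le). exists m. apply HM.
      split; auto. apply Hm.
    - exists z. intros _. apply HM in Hz. repeat split; try apply Hz.
      intros w Hw Le. apply Min, HM. split; auto. apply Hw. }
  set (l y := proj1_sig (constructive_indefinite_description _ (leaf_ex y))).
  assert (Hl : forall y, y ∈ T -> leaf y (l y)).
  { intros y. unfold l.
    destruct (constructive_indefinite_description _ (leaf_ex y)). auto. }
  assert (leaf_fun : forall y z z', leaf y z -> leaf y z' -> z = z').
  { intros y z z' (M & Le & H) (M' & Le' & H'). apply WA; auto. }
  assert (lT : forall y, y ∈ T -> l y ∈ T) by (intros; now apply Hl).
  assert (l_le : forall y, y ∈ T -> rel R (l y) y) by (intros; now apply Hl).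
  assert (l_min : forall y z, y ∈ T -> z ∈ T -> rel R z (l y) -> z = l y)
    by (intros; now apply Hl).
  (* The minimal elements below [z] are among those below [y], so [l y], being below [z], is still
     the [W]-least of them. *)
  assert (l_coh : forall y z, y ∈ T -> z ∈ T -> rel R z y -> rel R (l y) z ->
    l z = l y).
  { intros y z Hy Hz Le Le'. apply (leaf_fun z); auto.
    destruct (Hl y Hy) as (M & _ & H). split; auto. split; auto.
    intros w Hw K. apply H; auto. apply (Trans w z y); auto. apply Hw. }
  clearbody l. clear leaf_ex HF.
  set (F x y := if excluded_middle_informative (rel R x y) then x else
    if excluded_middle_informative (rel R y x) then y else l y).
  assert (F_le : forall x y, rel R x y -> F x y = x).
  { intros x y H. unfold F. destruct excluded_middle_informative; tauto. }
  assert (F_ge : forall x y, x ∈ T -> y ∈ T -> rel R y x -> F x y = y).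
  { intros x y Hx Hy H. unfold F.
    destruct excluded_middle_informative; [now apply Anti|].
    destruct excluded_middle_informative; tauto. }
  assert (F_inc : forall x y, ~ rel R x y -> ~ rel R y x -> F x y = l y).
  { intros x y H H'. unfold F.
    repeat destruct excluded_middle_informative; tauto. }
  assert (cases : forall x y, rel R x y \/ rel R y x \/
    (~ rel R x y /\ ~ rel R y x)) by (intros; tauto).
  assert (FT : forall x y, x ∈ T -> y ∈ T -> F x y ∈ T).
  { intros x y Hx Hy. unfold F.
    repeat destruct excluded_middle_informative; auto. }
  clearbody F.
  destruct (binop_ex hZF T (fun x y z =>
    (rel R x y /\ z = x) \/ (rel R y x /\ z = y) \/
    (~ rel R x y /\ ~ rel R y x /\ leaf y z)) F) as (m & Hm & Hop); auto.
  { unfold leaf. definability. }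
  { intros x y z Hx Hy. destruct (cases x y) as [K|[K|[K K']]].
    - rewrite F_le; auto. split; [|tauto].
      intros [[_ H]|[[K' H]|[K' _]]]; subst; auto; tauto.
    - rewrite F_ge; auto. split; [|tauto].
      intros [[K' H]|[[_ H]|[_ [K' _]]]]; subst; auto; tauto.
    - rewrite F_inc; auto. split.
      + intros [H|[H|[_ [_ H]]]]; [tauto|tauto|]. eapply leaf_fun; eauto.
      + intros ->. right; right; auto. }
  (* If [x] and [l y] are comparable, minimality of [l y] gives the value; otherwise it is
     [l (l y)], which is [l y] by coherence. *)
  assert (F_const : forall x y, x ∈ T -> y ∈ T -> F x (l y) = l y).
  { intros x y Hx Hy. destruct (cases x (l y)) as [K|[K|[K K']]].
    - rewrite F_le; auto.
    - rewrite F_ge; auto.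
    - rewrite F_inc; auto. }
  assert (F_below : forall x y, x ∈ T -> y ∈ T -> rel R (F x y) y).
  { intros x y Hx Hy. destruct (cases x y) as [K|[K|[K K']]].
    - now rewrite F_le.
    - rewrite F_ge; auto.
    - rewrite F_inc; auto. }
  (* Incomparability with [z] passes from [y] down to [w]: if [w] were below [z], then [y] and [z]
     would both lie in the linearly ordered set above [w]. *)
  assert (F_inc_below : forall w y z, w ∈ T -> y ∈ T -> z ∈ T ->
    ~ rel R y z -> ~ rel R z y -> rel R w y -> F w z = l z).
  { intros w y z Hw Hy Hz K K' Le. apply F_inc; intros H.
    - destruct (HT w y z) as [X|X]; auto.
    - apply K'. apply (Trans z w y); auto. }
  assert (F_assoc : forall x y z, x ∈ T -> y ∈ T -> z ∈ T ->
    F (F x y) z = F x (F y z)).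
  { intros x y z Hx Hy Hz. destruct (cases y z) as [K|[K|[K K']]].
    - rewrite (F_le y z); auto. apply F_le.
      apply (Trans _ y); auto.
    - rewrite (F_ge y z); auto. destruct (cases x y) as [C|[C|[C C']]].
      + now rewrite (F_le x y).
      + rewrite (F_ge x y), (F_ge y z), (F_ge x z); auto.
        apply (Trans z y x); auto.
      (* Here [z] is below [y], and [x] is incomparable with both. It remains to see that
         [F (l y) z = l z], by coherence if [l y] is below [z] and by minimality of [l y] if [z] is
         below it. *)
      + rewrite (F_inc x y), (F_inc x z); auto.
        * destruct (cases (l y) z) as [D|[D|[D D']]].
          -- rewrite F_le; auto. symmetry; now apply l_coh.
          -- assert (z = l y) by auto. subst z.
             rewrite F_le; auto. symmetry; apply l_coh; auto.
          -- now rewrite F_inc.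
        * intros D. apply C. apply (Trans x z y); auto.
        * intros D. destruct (HT z x y); auto.
    (* Both sides are [l z]: on the left, [F x y] lies below [y] and so is incomparable with [z]. *)
    - rewrite (F_inc y z), F_const; auto.
      apply (F_inc_below _ y); auto. }
  exists m. split; [split; [exact Hm|split; [|split]]|split; [exact Hm|]].
  - intros x y z xy yz a b Hx Hy Hz H1 H2 H3 H4.
    apply Hop in H1, H2, H3, H4.
    destruct H1 as (_ & _ & ->), H2 as (_ & _ & ->), H3 as (_ & _ & ->),
      H4 as (_ & _ & ->). auto.
  - intros x Hx. apply Hop. repeat split; auto. symmetry; auto.
  - intros x y xy a b Hx Hy H1 H2 H3.
    apply Hop in H1, H2, H3.
    destruct H1 as (_ & _ & ->), H2 as (_ & _ & ->), H3 as (_ & _ & ->).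
    destruct (cases x y) as [K|[K|[K K']]].
    + rewrite (F_le x y), (F_ge y x); auto.
    + rewrite (F_ge x y); auto.
    + rewrite (F_inc y x); auto. apply (F_inc_below _ y); auto.
  - intros x y Hx Hy. rewrite Hop. split.
    + intros H. repeat split; auto. symmetry; auto.
    + intros (_ & _ & E). rewrite E. auto.
Qed.

(** The reflexive-transitive closure of [S] from [x], as an intersection of closed sets, which
    avoids iteration along the natural numbers of the structure. *)
Definition orbit (S x z : V) : Prop :=
  forall D, x ∈ D -> (forall u v, u ∈ D -> rel S u v -> v ∈ D) -> z ∈ D.

Lemma choice_finite_branches_foliated (T R : V) : axiom_of_choice V ->
  is_poset T R -> has_finite_branches T R -> foliated T R.
Proof.
  intros AC HP HB x Hx. pose proof HP as (Rel & Refl & Anti & Trans).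
  destruct (well_ordering hZF T AC) as (W & WA & WO).
  (* [S] leads from a point to the [W]-least one strictly below it, and is undefined exactly at
     minimal elements. *)
  destruct (relation_ex hZF T T (fun y z => rel R z y /\ z <> y /\
    forall u, rel R u y -> u <> y -> rel W z u)) as (S & _ & HS);
    [definability|].
  assert (S_fun : forall y z z', rel S y z -> rel S y z' -> z = z').
  { intros y z z' H H'. apply HS in H, H'.
    destruct H as (_ & _ & Le & Ne & H), H' as (_ & _ & Le' & Ne' & H').
    apply WA; auto. }
  assert (O_step : forall y z z', orbit S y z -> rel S z z' -> orbit S y z').
  { intros y z z' H K D HD Cl. apply (Cl z z'); auto. }
  assert (O_ind : forall (P : V -> Prop) y, definable (fun e => P (e 0)) ->
    y ∈ T -> P y -> (forall u v, orbit S y u -> P u -> rel S u v -> P v) ->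
    forall z, orbit S y z -> P z).
  { intros P y D Hy H0 H1 z Hz.
    destruct (separation hZF (fun z => orbit S y z /\ P z) T) as [E HE].
    { unfold orbit. definability. }
    apply (HE z), Hz.
    - apply HE. repeat split; auto. intros D' H _. exact H.
    - intros u v Hu Huv. apply HE in Hu. destruct Hu as (Hu & Ou & Pu).
      apply HE. split; [|split].
      + apply HS in Huv. tauto.
      + apply (O_step y u v); auto.
      + apply (H1 u v); auto. }
  assert (OT : forall y z, y ∈ T -> orbit S y z -> z ∈ T).
  { intros y z Hy. apply (O_ind (fun z => z ∈ T)); auto; [definability|].
    intros u v _ _ H. apply HS in H. tauto. }
  assert (O_le : forall y z, y ∈ T -> orbit S y z -> rel R z y).
  { intros y z Hy. apply (O_ind (fun z => rel R z y)); auto; [definability|].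
    intros u v Ou Le H. pose proof (OT y u Hy Ou). apply HS in H.
    apply (Trans v u y); tauto. }
  assert (O_cmp : forall y z, orbit S x y -> orbit S x z ->
    orbit S y z \/ orbit S z y).
  { intros y z Hy. apply (O_ind (fun z => orbit S y z \/ orbit S z y)); auto.
    { unfold orbit. definability. }
    intros u v Ou [H|H] Huv; [left; now apply (O_step y u v)|].
    (* Since [S] is single-valued, any path from [u] that leaves [u] passes through its successor
       [v] first. *)
    assert (K : y = u \/ orbit S v y).
    { revert H. apply (O_ind (fun w => w = u \/ orbit S v w)); auto.
      - unfold orbit. definability.
      - now apply (OT x).
      - intros w w' _ [->|K] H; right.
        + rewrite (S_fun u w' v); auto. intros D HD _. exact HD.
        + now apply (O_step v w w'). }
    destruct K as [->|K]; auto. left. intros D HD Cl. now apply (Cl u v). }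
  destruct (separation hZF (orbit S x) T) as [C HC].
  { unfold orbit. definability. }
  assert (Ch : is_chain T R C).
  { split; [intros z Hz; now apply HC in Hz|].
    intros y z Hy Hz. apply HC in Hy, Hz.
    destruct (O_cmp y z) as [O|O]; try tauto; [right|left]; apply O_le; tauto. }
  destruct (finite_chain_min hZF T R C HP Ch (HB C Ch)) as (m & Hm & Min).
  { exists x. apply HC. split; auto. intros D H _. exact H. }
  apply HC in Hm. destruct Hm as [Hm Om].
  exists m. split; [split; auto|auto].
  (* If [m] were not minimal, its [S]-successor would lie in the orbit strictly below [m], the least
     element of the orbit. *)
  intros y Hy Le. apply NNPP. intros Ne.
  destruct (separation hZF (fun u => rel R u m /\ u <> m) T) as [Y HY];
    [definability|].
  destruct (WO Y) as (z & Hz & Wz).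
  { intros u Hu. now apply HY in Hu. }
  { exists y. apply HY; auto. }
  apply HY in Hz. destruct Hz as (Hz & Lz & Nz).
  apply Nz, Anti; auto. apply Min, HC. split; auto.
  apply (O_step x m z); auto. apply HS. repeat split; auto.
  intros u Hu Nu. apply Wz, HY. repeat split; auto.
  now apply (relation_dom hZF R T T u m).
Qed.

End Trees.

(** * The tree of a family of sets *)

Section ChoiceTree.
Context {V : membership_structure} (hZF : ZF V).

(* A member [a] of [A] is the vertex (a, a), which is not one of the leaves
   (a, y) with [y ∈ a] since [a ∉ a]; the empty set is the top. *)
Definition tree_vertex (A p : V) : Prop :=
  is_empty p \/ exists a y, a ∈ A /\ is_opair p a y /\ (y ∈ a \/ y = a).

Definition tree_order (p q : V) : Prop :=
  is_empty q \/ p = q \/ exists a y, is_opair p a y /\ is_opair q a a.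

Definition choice_tree (A T R : V) : Prop :=
  (forall p, p ∈ T <-> tree_vertex A p) /\
  is_relation R T T /\
  forall p q, rel R p q <-> p ∈ T /\ q ∈ T /\ tree_order p q.

Lemma choice_tree_ex (A : V) : exists T R, choice_tree A T R.
Proof.
  destruct (ZF_union V hZF A) as [U HU].
  destruct (union2_ex hZF U A) as [B HB].
  destruct (product_ex hZF A B) as [C HC].
  destruct (empty_ex hZF) as [o Ho].
  destruct (adjoin_ex hZF C o) as [D HD].
  destruct (separation hZF (tree_vertex A) D) as [T HT];
    [unfold tree_vertex; definability|].
  destruct (relation_ex hZF T T tree_order) as (R & Rel & HR);
    [unfold tree_order; definability|].
  exists T, R. split; [|split; auto].
  intros p. rewrite HT. split; [tauto|]. intros Hp. split; auto.
  apply HD. destruct Hp as [Hp|(a & y & Ha & Hp & Hy)].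
  - right. apply (ext hZF). intros z. specialize (Hp z). specialize (Ho z). tauto.
  - left. apply HC. exists a, y. repeat split; auto. apply HB.
    destruct Hy as [Hy| ->]; auto. left. apply HU. eauto.
Qed.

Lemma empty_unique (x y : V) : is_empty x -> is_empty y -> x = y.
Proof.
  intros Hx Hy. apply (ext hZF). intros z. specialize (Hx z). specialize (Hy z).
  tauto.
Qed.

Section Properties.
Context (A T R : V) (HTR : choice_tree A T R).

Let HT : forall p, p ∈ T <-> tree_vertex A p := proj1 HTR.
Let HR : forall p q, rel R p q <-> p ∈ T /\ q ∈ T /\ tree_order p q :=
  proj2 (proj2 HTR).

(** This treats both kinds of nonempty vertex at once: for a leaf, [y = a] is impossible since [a]
    is not a member of itself. *)
Lemma below_vertex (p q a y : V) : p ∈ T -> is_opair q a y ->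
  rel R p q -> p = q \/ y = a /\ exists y', y' ∈ a /\ is_opair p a y'.
Proof.
  intros Hp Hq H. apply HR in H. destruct H as (_ & _ & [H|[H|H]]); auto.
  - now destruct (opair_nonempty hZF q a y Hq).
  - destruct H as (b & y' & Hp' & Hq').
    destruct (opair_inj hZF q a y b b); auto. subst y b.
    apply HT in Hp. destruct Hp as [Hp|(b & y & _ & Hp & Hy)].
    + now destruct (opair_nonempty hZF p a y' Hp').
    + destruct (opair_inj hZF p a y' b y); auto. subst b y'.
      destruct Hy as [Hy| ->]; [right; eauto|].
      left. now apply (opair_fun hZF p q a a).
Qed.

Lemma leaf_minimal (q a y : V) : a ∈ A -> y ∈ a -> is_opair q a y ->
  is_minimal T R q.
Proof.
  intros Ha Hy Hq. split.
  - apply HT. right. exists a, y. auto.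
  - intros p Hp H. destruct (below_vertex p q a y) as [E|[E _]]; auto.
    subst y. now apply (mem_irrefl hZF) in Hy.
Qed.

Lemma choice_tree_is_tree : is_tree T R.
Proof.
  assert (Up : forall x y z, x ∈ T -> rel R x y -> rel R x z ->
    rel R y z \/ rel R z y).
  { intros x y z Hx H H'. apply HR in H, H'.
    destruct H as (_ & Hy & H), H' as (_ & Hz & H').
    rewrite !HR. unfold tree_order.
    destruct H as [H|[H|(a & u & H & K)]]; [auto 6|subst; auto|].
    destruct H' as [H'|[H'|(b & v & H' & K')]]; [auto 6| |].
    - subst z. right. repeat split; auto. right; right. exists a, u. auto.
    - destruct (opair_inj hZF x a u b v); auto. subst b v.
      left. rewrite (opair_fun hZF y z a a); auto. }
  split; [split; [apply HTR|split; [|split]]|split].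
  - intros x Hx. apply HR. unfold tree_order. auto.
  - intros x y Hx Hy H H'. pose proof Hy as Hy'.
    apply HT in Hy'. destruct Hy' as [E|(a & u & _ & Hu & _)].
    + pose proof Hx as Hx'. apply HT in Hx'.
      destruct Hx' as [E'|(a & u & _ & Hu & _)].
      * now apply empty_unique.
      * destruct (below_vertex y x a u) as [->|(_ & v & _ & K)]; auto.
        now destruct (opair_nonempty hZF y a v K).
    + destruct (below_vertex x y a u) as [->|(-> & v & Hv & K)]; auto.
      destruct (below_vertex y x a v) as [->|(-> & _)]; auto.
      now apply (mem_irrefl hZF) in Hv.
  - intros x y z Hx Hy Hz H H'. pose proof Hz as Hz'. apply HT in Hz'.
    destruct Hz' as [E|(a & u & _ & Hu & _)].
    + apply HR. unfold tree_order. auto.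
    + destruct (below_vertex y z a u) as [->|(-> & v & Hv & K)]; auto.
      destruct (below_vertex x y a v) as [->|(-> & _)]; auto.
      now apply (mem_irrefl hZF) in Hv.
  - destruct (empty_ex hZF) as [o Ho]. exists o.
    assert (M : o ∈ T) by (apply HT; left; auto).
    split; auto. intros x Hx. apply HR. unfold tree_order. auto.
  - eauto.
Qed.

Lemma choice_tree_foliated (a0 x0 : V) : a0 ∈ A -> x0 ∈ a0 ->
  (forall a, a ∈ A -> exists y, y ∈ a) -> foliated T R.
Proof.
  intros Ha0 Hx0 NE p Hp. pose proof Hp as Hp'. apply HT in Hp'.
  destruct Hp' as [E|(a & u & Ha & Hu & [K| ->])].
  (* The fixed leaf [(a0, x0)] serves below the top. *)
  - destruct (opair_ex hZF a0 x0) as [q Hq].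
    pose proof (leaf_minimal q a0 x0 Ha0 Hx0 Hq) as M.
    exists q. split; auto. apply HR. repeat split; auto; [apply M|].
    left; auto.
  - exists p. split; [now apply (leaf_minimal p a u)|].
    apply HR. repeat split; auto. right; left; auto.
  - destruct (NE a Ha) as [y Hy]. destruct (opair_ex hZF a y) as [q Hq].
    pose proof (leaf_minimal q a y Ha Hy Hq) as M.
    exists q. split; auto. apply HR. repeat split; auto; [apply M|].
    right; right. exists a, y. auto.
Qed.

(** The level, counted upwards from the leaves, maps every chain injectively into [n]. A leaf, the
    vertex above it and the top attain the bound. *)
Lemma choice_tree_height (a0 x0 n : V) : a0 ∈ A -> x0 ∈ a0 ->
  is_numeral 3 n -> has_height T R n.
Proof.
  intros Ha0 Hx0 Hn. pose proof (natural_numeral hZF 3 n Hn) as Nn.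
  destruct Hn as (n2 & (n1 & (n0 & H0 & H1) & H2) & H3).
  assert (n01 : n0 ∈ n1) by (apply H1; auto).
  assert (n02 : n0 ∈ n2) by (apply H2; auto).
  assert (n12 : n1 ∈ n2) by (apply H2; auto).
  assert (In : forall i, i ∈ n <-> i = n0 \/ i = n1 \/ i = n2).
  { intros i. rewrite (H3 i), (H2 i), (H1 i). specialize (H0 i). tauto. }
  assert (d01 : n0 <> n1) by (intros E; rewrite E in n01; now apply (mem_irrefl hZF) in n01).
  assert (d02 : n0 <> n2) by (intros E; rewrite E in n02; now apply (mem_irrefl hZF) in n02).
  assert (d12 : n1 <> n2) by (intros E; rewrite E in n12; now apply (mem_irrefl hZF) in n12).
  clear H0 H1 H2 H3 n01 n02 n12.
  set (level (p i : V) := (is_empty p /\ i = n2) \/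
    (exists a, is_opair p a a /\ i = n1) \/
    (exists a y, is_opair p a y /\ y ∈ a /\ i = n0)).
  assert (L : forall C, is_chain T R C -> exists f, is_injection f C n /\
    forall p i, rel f p i <-> p ∈ C /\ i ∈ n /\ level p i).
  { intros C [Sub Lin]. apply (injection_ex hZF); unfold level.
    - definability.
    - intros p Hp. apply Sub, HT in Hp.
      destruct Hp as [Hp|(a & y & _ & Hp & [Hy| ->])].
      + exists n2. rewrite In. auto.
      + exists n0. rewrite In. split; auto. right; right. exists a, y; auto.
      + exists n1. rewrite In. split; auto. right; left. exists a; auto.
    - intros p i j _ [[Hp ->]|[(a & Hp & ->)|(a & y & Hp & Hy & ->)]]
        [[Hq ->]|[(b & Hq & ->)|(b & z & Hq & Hz & ->)]]; auto.
      + now destruct (opair_nonempty hZF p b b).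
      + now destruct (opair_nonempty hZF p b z).
      + now destruct (opair_nonempty hZF p a a).
      + destruct (opair_inj hZF p a a b z); auto. subst.
        now apply (mem_irrefl hZF) in Hz.
      + now destruct (opair_nonempty hZF p a y).
      + destruct (opair_inj hZF p a y b b); auto. subst.
        now apply (mem_irrefl hZF) in Hy.
    (* Comparable vertices of equal level coincide, which gives injectivity on chains. *)
    - assert (Le : forall p q i, p ∈ T -> rel R p q ->
        level p i -> level q i -> p = q).
      { intros p q i Hp H Hpi Hqi.
        destruct Hqi as [[Hq ->]|[(b & Hq & ->)|(b & z & Hq & Hz & ->)]].
        - destruct Hpi as [[K _]|[(a & _ & K)|(a & y & _ & _ & K)]];
            [|congruence|congruence]. now apply empty_unique.
        - destruct (below_vertex p q b b) as [E|(_ & u & Hu & K)]; auto.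
          destruct Hpi as [[_ E]|[(a & K' & _)|(a & y & _ & _ & E)]];
            [congruence| |congruence].
          destruct (opair_inj hZF p b u a a); auto. subst.
          now apply (mem_irrefl hZF) in Hu.
        - destruct (below_vertex p q b z) as [E|[-> _]]; auto.
          now apply (mem_irrefl hZF) in Hz. }
      intros p q i Hp Hq Hpi Hqi. destruct (Lin p q Hp Hq) as [K|K].
      + apply (Le p q i); auto.
      + symmetry. apply (Le q p i); auto. }
  split; [|split].
  - intros C HC. apply (finite_card_le hZF n); auto.
    destruct (L C HC) as (f & Hf & _). now exists f.
  - intros C HC. destruct (L C HC) as (f & Hf & _). now exists f.
  - destruct (empty_ex hZF) as [o Ho].
    destruct (opair_ex hZF a0 a0) as [q Hq], (opair_ex hZF a0 x0) as [p Hp].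
    destruct (upair_ex hZF p q) as [B HB].
    destruct (adjoin_ex hZF B o) as [C HC].
    assert (InC : forall x, x ∈ C <-> x = p \/ x = q \/ x = o).
    { intros x. rewrite HC, (HB x). tauto. }
    assert (pT : p ∈ T) by (apply HT; right; exists a0, x0; auto).
    assert (qT : q ∈ T) by (apply HT; right; exists a0, a0; auto).
    assert (oT : o ∈ T) by (apply HT; left; auto).
    assert (Ch : is_chain T R C).
    { split.
      - intros x Hx. apply InC in Hx. destruct Hx as [->|[->| ->]]; auto.
      - assert (pq : rel R p q).
        { apply HR. repeat split; auto. right; right. exists a0, x0. auto. }
        assert (xo : forall x, x ∈ T -> rel R x o).
        { intros x Hx. apply HR. repeat split; auto. left; auto. }
        assert (xx : forall x, x ∈ T -> rel R x x).
        { intros x Hx. apply HR. repeat split; auto. right; left; auto. }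
        intros x y Hx Hy. apply InC in Hx, Hy.
        destruct Hx as [->|[->| ->]], Hy as [->|[->| ->]]; auto. }
    exists C. split; auto. destruct (L C Ch) as (f & Hf & Hlev).
    exists f. split; auto. intros i Hi. pose proof Hi as Hi'. apply In in Hi.
    destruct Hi as [->|[->| ->]]; [exists p|exists q|exists o];
      apply Hlev; rewrite InC; repeat split; auto; unfold level.
    + right; right. exists a0, x0. auto.
    + right; left. exists a0. auto.
    + left. auto.
Qed.

(* For a leaf [p], [p·n] lies below [n], and [p·n = n] would give
   [q = q·n = q·(p·n) = (q·p)·n = p·n = n] for every leaf [q <= n]. *)
Lemma choice_of_associative (a0 x0 U : V) : a0 ∈ A -> x0 ∈ a0 ->
  (forall a, a ∈ A -> exists y, y ∈ a) -> is_union U A ->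
  associative_poset T R ->
  exists f, is_function f A U /\ forall a y, a ∈ A -> rel f a y -> y ∈ a.
Proof.
  intros Ha0 Hx0 NE HU (_ & m & (Hm & Assoc & Idem & _) & _ & Adm).
  destruct (binop_fun hZF m T Hm) as [F HF].
  assert (FT : forall x y, x ∈ T -> y ∈ T -> F x y ∈ T)
    by (intros; now apply HF).
  assert (FA : forall x y z, x ∈ T -> y ∈ T -> z ∈ T ->
    F (F x y) z = F x (F y z)).
  { intros x y z Hx Hy Hz.
    apply (Assoc x y z (F x y) (F y z)); auto; apply HF; auto. }
  assert (FI : forall x, x ∈ T -> F x x = x).
  { intros x Hx. symmetry. apply (HF x x Hx Hx). auto. }
  assert (FL : forall x y, x ∈ T -> y ∈ T -> (rel R x y <-> F x y = x)).
  { intros x y Hx Hy. rewrite (Adm x y Hx Hy), (proj2 (HF x y Hx Hy) x).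
    split; auto. }
  (* By associativity and idempotence, [(x·y)·y = x·(y·y) = x·y]. *)
  assert (Fle : forall x y, x ∈ T -> y ∈ T -> rel R (F x y) y).
  { intros x y Hx Hy. apply FL; auto. rewrite FA, FI; auto. }
  destruct (opair_ex hZF a0 x0) as [p Hp].
  destruct (leaf_minimal p a0 x0 Ha0 Hx0 Hp) as [pT pMin].
  assert (Key : forall a n, a ∈ A -> is_opair n a a ->
    exists y, y ∈ a /\ is_opair (F p n) a y).
  { intros a n Ha Hn.
    assert (nT : n ∈ T) by (apply HT; right; exists a, a; auto).
    destruct (below_vertex (F p n) n a a) as [E|[_ H]]; auto.
    destruct (NE a Ha) as [y Hy]. destruct (opair_ex hZF a y) as [q Hq].
    destruct (leaf_minimal q a y Ha Hy Hq) as [qT _].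
    assert (qn : F q n = q).
    { apply FL; auto. apply HR. repeat split; auto.
      right; right. exists a, y. auto. }
    assert (qp : F q p = p) by (apply pMin; auto).
    exfalso. pose proof (FA q p n qT pT nT) as K. rewrite qp, E, qn in K.
    subst q. destruct (opair_inj hZF n a a a y); auto. subst y.
    now apply (mem_irrefl hZF) in Hy. }
  (* The choice at [a] is the second coordinate of the leaf [p·(a, a)]; the single fixed leaf [p]
     serves all [a]. *)
  destruct (function_ex hZF A U (fun a y => exists n q,
    is_opair n a a /\ is_opair q a y /\ op m p n q)) as (f & Hf & Hrel).
  - definability.
  - intros a Ha. destruct (opair_ex hZF a a) as [n Hn].
    destruct (Key a n Ha Hn) as (y & Hy & Hq).
    exists y. split; [apply HU; eauto|]. exists n, (F p n).
    repeat split; auto. apply HF; auto. apply HT. right. exists a, a. auto.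
  - intros a y y' Ha (n & q & Hn & Hq & Hop) (n' & q' & Hn' & Hq' & Hop').
    rewrite (opair_fun hZF n' n a a) in Hop'; auto.
    assert (nT : n ∈ T) by (apply HT; right; exists a, a; auto).
    apply HF in Hop, Hop'; auto. subst q q'.
    now destruct (opair_inj hZF (F p n) a y a y').
  - exists f. split; auto. intros a y Ha H.
    apply Hrel in H. destruct H as (_ & _ & n & q & Hn & Hq & Hop).
    assert (nT : n ∈ T) by (apply HT; right; exists a, a; auto).
    apply HF in Hop; auto. subst q.
    destruct (Key a n Ha Hn) as (z & Hz & Hq').
    now destruct (opair_inj hZF (F p n) a y a z); subst.
Qed.

End Properties.

(** The premise asks for associativity only of trees that are both foliated and of height three, so
    that the statements on foliated trees and on trees of height three both imply it. *)
Lemma choice_of_trees :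
  (forall T R : V, is_tree T R -> foliated T R ->
     (forall n, is_numeral 3 n -> has_height T R n) ->
     associative_poset T R) ->
  axiom_of_choice V.
Proof.
  intros H A NE. destruct (ZF_union V hZF A) as [U HU].
  destruct (classic (exists a0, a0 ∈ A)) as [[a0 Ha0]|E].
  - destruct (NE a0 Ha0) as [x0 Hx0].
    destruct (choice_tree_ex A) as (T & R & HTR).
    destruct (choice_of_associative A T R HTR a0 x0 U) as (f & Hf & Hc); auto.
    + apply H.
      * now apply (choice_tree_is_tree A).
      * now apply (choice_tree_foliated A T R HTR a0 x0).
      * intros n Hn. now apply (choice_tree_height A T R HTR a0 x0).
    + exists U, f. auto.
  (* For empty [A] there is no leaf to start from, and the empty function is a choice function. *)
  - destruct (function_ex hZF A U (fun _ _ => False)) as (f & Hf & Hrel).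
    + definability.
    + intros x Hx. exfalso; eauto.
    + tauto.
    + exists U, f. split; auto. split; auto. intros x y Hx. exfalso; eauto.
Qed.

End ChoiceTree.

Theorem theorem6p2 (V : membership_structure) (hZF : ZF V) :
  (foliated_trees_associative V <-> finite_branch_trees_associative V) /\
  (finite_branch_trees_associative V <-> height_trees_associative 3 V) /\
  (height_trees_associative 3 V <-> axiom_of_choice V).
Proof.
  assert (H14 : foliated_trees_associative V -> axiom_of_choice V).
  { intros H. apply (choice_of_trees hZF). auto. }
  assert (H34 : height_trees_associative 3 V -> axiom_of_choice V).
  { intros H. apply (choice_of_trees hZF). intros T R HT _ HH.
    destruct (numeral_ex hZF 3) as [n Hn]. apply (H T R n); auto. }
  assert (H41 : axiom_of_choice V -> foliated_trees_associative V).
  { intros AC T R. now apply choice_foliated_associative. }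
  assert (H42 : axiom_of_choice V -> finite_branch_trees_associative V).
  { intros AC T R HT HB. apply H41; auto.
    apply choice_finite_branches_foliated; auto. apply HT. }
  (* Having a height includes having finite branches. With this, every tree statement implies choice
     and choice implies every tree statement. *)
  assert (H23 : finite_branch_trees_associative V ->
    height_trees_associative 3 V).
  { intros H T R n _ HT [HB _]. auto. }
  tauto.
Qed.
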